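(* Let $0<A_1<B_1$ and $0<A_2<B_2$ be real numbers with $B_1/A_1 > B_2/A_2$. Then every holomorphic mapping $$f\colon \{z\in\mathbb{C} \colon A_1 < |z| < B_1\} \to \{z \in\mathbb{C}\colon A_2 < |z| < B_2\}$$ is homotopically trivial, that is, $f$ is homotopic to a constant map (as a continuous map between these two annuli).
   Context: All notions are standard; homotopy means homotopy through continuous maps. *)

(* Defs.v *)
From Stdlib Require Import Reals.
From Coquelicot Require Import Coquelicot.
Open Scope R_scope.

Definition annulus (A B : R) (z : C) : Prop := A < Cmod z < B.

(* Maps between subsets are encoded as total functions whose values outside
   the source are irrelevant. *)
Definition maps_into {U V : Type} (X : U -> Prop) (Y : V -> Prop)
    (f : U -> V) : Prop :=
  forall x, X x -> Y (f x).

(* Meant for open D. The scalar ring is pinned to the complex numbers, so this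
   is complex, not real, differentiability. *)
Definition holomorphic_on (D : C -> Prop) (f : C -> C) : Prop :=
  forall z, D z -> @ex_derive C_AbsRing C_NormedModule f z.

(* Here continuous_on is continuity for the subspace topology, and the
   homotopy takes all its values in Y. *)
Definition homotopic {U V : UniformSpace} (X : U -> Prop) (Y : V -> Prop)
    (f g : U -> V) : Prop :=
  exists H : R * U -> V,
    continuous_on (fun p : R * U => 0 <= fst p <= 1 /\ X (snd p)) H /\
    maps_into (fun p : R * U => 0 <= fst p <= 1 /\ X (snd p)) Y H /\
    (forall x, X x -> H (0, x) = f x) /\
    (forall x, X x -> H (1, x) = g x).

Definition homotopically_trivial {U V : UniformSpace} (X : U -> Prop)
    (Y : V -> Prop) (f : U -> V) : Prop :=
  exists c : V, Y c /\ homotopic X Y f (fun _ => c).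

(* Main.v *)
Require Import Defs.
From Stdlib Require Import Reals ZArith Lra Lia Classical ClassicalEpsilon.
From Coquelicot Require Import Coquelicot.
Open Scope R_scope.

(** Work in logarithmic coordinates: [f (exp (s + i t))] is a zero-free
    function on the strip [ln A1 < s < ln B1], so it has a logarithm [u + i v]
    there, with [u] single-valued and [v] continuous.  The function
    [v (s, t + 2 * PI) - v (s, t)] takes values in the multiples of [2 * PI],
    hence does not depend on [s]; write it [2 * PI * k], where [k] is the
    winding number of the image of a circle.  Integrating the holomorphic
    function [u + i v] along the boundary of a rectangle of height [2 * PI]
    gives, by Cauchy's theorem, that the mean of [u] over a vertical segment of
    that height is an affine function of [s] with slope [k].  This mean lies
    between [ln A2] and [ln B2] while [s] runs through an interval of length
    [ln B1 - ln A1 > ln B2 - ln A2], so the integer [k] must be [0]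
    ([period_zero]).  Then [v] is periodic and the logarithm of [f] descends to a
    continuous function on the source annulus; contracting its values along
    segments inside the convex strip [ln A2 < u < ln B2] contracts [f].

    Three facts carry the argument.  A continuous zero-free function on the plane
    has a continuous argument ([plane_argument]).  The flux of a totally
    differentiable field of zero divergence through the boundary of a rectangle
    vanishes, without any continuity of the partial derivatives ([flux_zero]);
    this is the imaginary part of Cauchy's theorem, and the only part that
    matters here.  Finally [ln] of the modulus and the continuous argument
    of a holomorphic map satisfy the equation that this needs
    ([log_divergence_free]).  *)

(** * Continuity of basic operations *)

Section RealContinuity.
Context {T : UniformSpace}.
Implicit Types (f g : T -> R) (p : T).

Lemma continuous_Rplus f g p :
  continuous f p -> continuous g p -> continuous (fun q => f q + g q) p.
Proof. exact (@continuous_plus T R_AbsRing R_NormedModule f g p). Qed.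

Lemma continuous_Rminus f g p :
  continuous f p -> continuous g p -> continuous (fun q => f q - g q) p.
Proof. exact (@continuous_minus T R_AbsRing R_NormedModule f g p). Qed.

Lemma continuous_Rmult f g p :
  continuous f p -> continuous g p -> continuous (fun q => f q * g q) p.
Proof. exact (@continuous_mult T R_AbsRing f g p). Qed.

Lemma continuous_Rdiv f g p :
  continuous f p -> continuous g p -> g p <> 0 ->
  continuous (fun q => f q / g q) p.
Proof.
  intros Hf Hg Hn. apply continuous_Rmult; [exact Hf|].
  apply (continuous_comp g Rinv); [exact Hg|].
  apply continuous_Rinv, Hn.
Qed.

Lemma locally_lt f g p :
  continuous f p -> continuous g p -> f p < g p ->
  locally p (fun q => f q < g q).
Proof.
  intros Hf Hg Hlt.
  assert (H : locally p (fun q => 0 < g q - f q)).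
  { apply (continuous_Rminus g f p Hg Hf). apply open_gt. lra. }
  revert H. apply filter_imp. intros q; lra.
Qed.

End RealContinuity.

Lemma continuous_pair {T U V : UniformSpace} (f : T -> U) (g : T -> V) (p : T) :
  continuous f p -> continuous g p ->
  @continuous T (prod_UniformSpace U V) (fun q => (f q, g q)) p.
Proof.
  intros Hf Hg. apply filterlim_locally. intros eps.
  generalize (filter_and _ _ (proj1 (filterlim_locally _ _) Hf eps)
    (proj1 (filterlim_locally _ _) Hg eps)).
  apply filter_imp. intros q [H1 H2]. split; assumption.
Qed.

Lemma continuous_fst_comp {T U V : UniformSpace}
    (f : T -> prod_UniformSpace U V) (p : T) :
  continuous f p -> continuous (fun q => fst (f q)) p.
Proof.
  intros Hf. apply (continuous_comp f fst); [exact Hf|].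
  destruct (f p); apply continuous_fst.
Qed.

Lemma continuous_snd_comp {T U V : UniformSpace}
    (f : T -> prod_UniformSpace U V) (p : T) :
  continuous f p -> continuous (fun q => snd (f q)) p.
Proof.
  intros Hf. apply (continuous_comp f snd); [exact Hf|].
  destruct (f p); apply continuous_snd.
Qed.

Lemma continuous_sin x : continuous sin x.
Proof. apply continuity_pt_filterlim, continuity_sin. Qed.
Lemma continuous_cos x : continuous cos x.
Proof. apply continuity_pt_filterlim, continuity_cos. Qed.

(** * Arguments *)

Definition polar (r t : R) : C := (r * cos t, r * sin t).
Definition is_argument (z : C) (t : R) : Prop := z = polar (Cmod z) t.
Definition dot (z w : C) : R := fst z * fst w + snd z * snd w.
Definition cross (z w : C) : R := fst z * snd w - snd z * fst w.
(** The angle from [z] to [w], provided that it is acute. *)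
Definition turn (z w : C) : R := atan (cross z w / dot z w).

Lemma Cmod_polar r t : 0 <= r -> Cmod (polar r t) = r.
Proof.
  intros Hr. unfold Cmod, polar; simpl fst; simpl snd.
  replace ((r * cos t) ^ 2 + (r * sin t) ^ 2) with (r ^ 2).
  - apply sqrt_pow2, Hr.
  - generalize (sin2_cos2 t). unfold Rsqr. nra.
Qed.

Lemma Cmod_sqr (z : C) : Cmod z * Cmod z = fst z * fst z + snd z * snd z.
Proof.
  unfold Cmod. rewrite sqrt_sqrt; [ring|]. nra.
Qed.

Lemma dot_polar r s r' t :
  dot (polar r s) (polar r' t) = r * r' * cos (t - s).
Proof. unfold dot, polar; simpl; rewrite cos_minus; ring. Qed.

Lemma cross_polar r s r' t :
  cross (polar r s) (polar r' t) = r * r' * sin (t - s).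
Proof. unfold cross, polar; simpl; rewrite sin_minus; ring. Qed.

Lemma argument_exists (z : C) : exists t, is_argument z t.
Proof.
  destruct (Req_dec (Cmod z) 0) as [H0|H0].
  - exists 0. unfold is_argument. rewrite H0. rewrite (Cmod_eq_0 _ H0).
    unfold polar. rewrite !Rmult_0_l. reflexivity.
  - assert (Hp : 0 < Cmod z) by (generalize (Cmod_ge_0 z); lra).
    pose proof (Cmod_sqr z) as Hs. destruct z as [a b]. simpl fst in Hs; simpl snd in Hs.
    set (r := Cmod (a, b)) in *.
    assert (Hc : (a / r) * (a / r) + (b / r) * (b / r) = 1).
    { field_simplify; [|lra]. apply Rmult_eq_reg_r with (r ^ 2); [|nra].
      field_simplify; lra. }
    assert (Ha : -1 <= a / r <= 1) by nra.
    assert (Hq : sqrt (1 - (a / r)²) = Rabs (b / r)).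
    { rewrite <- sqrt_Rsqr_abs. f_equal. unfold Rsqr; lra. }
    destruct (Rle_dec 0 (b / r)) as [Hb|Hb].
    + exists (acos (a / r)). unfold is_argument, polar. fold r.
      rewrite cos_acos, sin_acos, Hq, Rabs_pos_eq by assumption.
      f_equal; field; lra.
    + exists (- acos (a / r)). unfold is_argument, polar. fold r.
      rewrite cos_neg, sin_neg, cos_acos, sin_acos, Hq, Rabs_left by lra.
      f_equal; field; lra.
Qed.

(** Lagrange's identity [dot ^ 2 + cross ^ 2 = |z| ^ 2 |w| ^ 2] turns the tangent
    of the angle from [z] to [w] into its cosine and sine; positivity of the
    scalar product selects the branch of the arc tangent. *)
Lemma turn_argument (z w : C) (t : R) :
  is_argument z t -> 0 < dot z w -> is_argument w (t + turn z w).
Proof.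
  intros Hz Hd.
  assert (Hr : 0 < Cmod z).
  { destruct (Cmod_ge_0 z) as [h|h]; [exact h|].
    rewrite (Cmod_eq_0 z) in Hd by auto. unfold dot in Hd; simpl in Hd. lra. }
  assert (HL : dot z w * dot z w + cross z w * cross z w
    = (Cmod z * Cmod w) * (Cmod z * Cmod w)).
  { replace ((Cmod z * Cmod w) * (Cmod z * Cmod w))
      with ((Cmod z * Cmod z) * (Cmod w * Cmod w)) by ring.
    rewrite !Cmod_sqr. unfold dot, cross. ring. }
  assert (Hw : 0 < Cmod z * Cmod w).
  { assert (0 <= Cmod z * Cmod w)
      by (apply Rmult_le_pos; apply Cmod_ge_0). nra. }
  assert (Hw' : 0 < Cmod w) by (apply Rmult_lt_reg_l with (Cmod z); lra).
  assert (Hq : sqrt (1 + (cross z w / dot z w)²) = Cmod z * Cmod w / dot z w).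
  { apply sqrt_lem_1.
    - generalize (Rle_0_sqr (cross z w / dot z w)); lra.
    - apply Rlt_le, Rdiv_lt_0_compat; assumption.
    - unfold Rsqr. field_simplify; [|lra|lra].
      apply Rmult_eq_reg_r with (dot z w ^ 2); [|nra].
      field_simplify; lra. }
  assert (Hcos : cos (turn z w) = dot z w / (Cmod z * Cmod w)).
  { unfold turn. rewrite cos_atan, Hq. field; lra. }
  assert (Hsin : sin (turn z w) = cross z w / (Cmod z * Cmod w)).
  { unfold turn. rewrite sin_atan, Hq. field; lra. }
  unfold is_argument, polar. rewrite cos_plus, sin_plus, Hcos, Hsin.
  assert (H1 : fst z = Cmod z * cos t) by (rewrite Hz at 1; reflexivity).
  assert (H2 : snd z = Cmod z * sin t) by (rewrite Hz at 1; reflexivity).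
  unfold dot, cross. rewrite H1, H2.
  pose proof (sin2_cos2 t) as Hsc. unfold Rsqr in Hsc.
  destruct w as [a b]; simpl fst; simpl snd. f_equal.
  - transitivity (a * (sin t * sin t + cos t * cos t)); [rewrite Hsc; ring|].
    field; lra.
  - transitivity (b * (sin t * sin t + cos t * cos t)); [rewrite Hsc; ring|].
    field; lra.
Qed.

Lemma turn_difference (z w : C) (s t : R) :
  is_argument z s -> is_argument w t -> 0 < Cmod z -> 0 < Cmod w ->
  Rabs (t - s) < PI / 2 -> 0 < dot z w /\ turn z w = t - s.
Proof.
  intros Hz Hw Pz Pw Hd. apply Rabs_def2 in Hd.
  assert (Hc : 0 < cos (t - s)) by (apply cos_gt_0; lra).
  unfold turn. rewrite Hz, Hw, dot_polar, cross_polar.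
  assert (Hm : 0 < Cmod z * Cmod w) by (apply Rmult_lt_0_compat; assumption).
  split; [apply Rmult_lt_0_compat; assumption|].
  replace (Cmod z * Cmod w * sin (t - s) / (Cmod z * Cmod w * cos (t - s)))
    with (tan (t - s)) by (unfold tan; field; lra).
  apply atan_tan. lra.
Qed.

Lemma argument_differ (z : C) (s t : R) :
  0 < Cmod z -> is_argument z s -> is_argument z t ->
  exists k : Z, t - s = 2 * IZR k * PI.
Proof.
  intros Hp Hs Ht.
  assert (Hc : cos (t - s) = 1).
  { pose proof (dot_polar (Cmod z) s (Cmod z) t) as H.
    rewrite <- Hs, <- Ht in H. unfold dot in H. rewrite <- Cmod_sqr in H.
    apply Rmult_eq_reg_l with (Cmod z * Cmod z); nra. }
  (* [cos (t - s) = 1] forces the sine of the half angle to vanish. *)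
  replace (t - s) with (2 * ((t - s) / 2)) in Hc |- * by field.
  rewrite cos_2a_sin in Hc.
  destruct (sin_eq_0_0 ((t - s) / 2)) as [k Hk]; [nra|].
  exists k. rewrite Hk. ring.
Qed.

Lemma argument_shift (z : C) (t : R) (k : Z) :
  is_argument z t -> is_argument z (t + 2 * IZR k * PI).
Proof.
  unfold is_argument, polar. intros H.
  assert (H2 : sin (2 * IZR k * PI) = 0).
  { apply sin_eq_0_1. exists (2 * k)%Z. rewrite mult_IZR. ring. }
  assert (H1 : cos (2 * IZR k * PI) = 1).
  { replace (2 * IZR k * PI) with (2 * (IZR k * PI)) by ring.
    rewrite cos_2a_sin, (sin_eq_0_1 (IZR k * PI)); [ring|]. exists k; ring. }
  rewrite cos_plus, sin_plus, H1, H2.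
  rewrite !Rmult_0_r, !Rmult_1_r, Rminus_0_r, Rplus_0_r. exact H.
Qed.

Section Continuity.
Context {T : UniformSpace}.

Lemma continuous_dot (f g : T -> C_UniformSpace) p :
  continuous f p -> continuous g p -> continuous (fun q => dot (f q) (g q)) p.
Proof.
  intros Hf Hg. unfold dot.
  apply continuous_Rplus; apply continuous_Rmult;
    (apply (continuous_fst_comp (U:=R_UniformSpace) (V:=R_UniformSpace))
     || apply (continuous_snd_comp (U:=R_UniformSpace) (V:=R_UniformSpace)));
    assumption.
Qed.

Lemma continuous_cross (f g : T -> C_UniformSpace) p :
  continuous f p -> continuous g p -> continuous (fun q => cross (f q) (g q)) p.
Proof.
  intros Hf Hg. unfold cross.
  apply continuous_Rminus; apply continuous_Rmult;
    (apply (continuous_fst_comp (U:=R_UniformSpace) (V:=R_UniformSpace))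
     || apply (continuous_snd_comp (U:=R_UniformSpace) (V:=R_UniformSpace)));
    assumption.
Qed.

Lemma continuous_turn (f g : T -> C_UniformSpace) p :
  continuous f p -> continuous g p -> dot (f p) (g p) <> 0 ->
  continuous (fun q => turn (f q) (g q)) p.
Proof.
  intros Hf Hg Hd. unfold turn.
  apply (continuous_comp (fun q => cross (f q) (g q) / dot (f q) (g q)) atan).
  - apply continuous_Rdiv;
      [apply continuous_cross|apply continuous_dot|]; assumption.
  - apply continuous_atan.
Qed.

Lemma continuous_Cmod (f : T -> C_UniformSpace) p :
  continuous f p -> continuous (fun q => Cmod (f q)) p.
Proof.
  intros Hf. apply continuous_ext with (fun q => sqrt (dot (f q) (f q))).
  - intros q. unfold Cmod, dot. f_equal. ring.
  - apply (continuous_comp (fun q => dot (f q) (f q)) sqrt).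
    + apply continuous_dot; assumption.
    + apply continuous_sqrt.
Qed.

Definition continuous_argument (g : T -> C_UniformSpace) (v : T -> R) : Prop :=
  forall p, continuous v p /\ is_argument (g p) (v p).

(** Adding the turn from [g] to [h], which is continuous while the angle stays
    acute, to an argument of [g] gives one of [h]. *)
Lemma continuous_argument_step (g h : T -> C_UniformSpace) :
  (forall p, continuous g p) -> (forall p, continuous h p) ->
  (forall p, 0 < dot (g p) (h p)) ->
  (exists v, continuous_argument g v) -> exists v, continuous_argument h v.
Proof.
  intros Hg Hh Hd [v Hv]. exists (fun p => v p + turn (g p) (h p)).
  intros p. destruct (Hv p) as [Hc Ha]. split.
  - apply continuous_Rplus; [exact Hc|].
    apply continuous_turn; auto. apply Rgt_not_eq, Hd.
  - apply turn_argument; auto.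
Qed.

End Continuity.

(** * Continuous arguments on the plane *)

(** This form of the retraction of the line onto [[-K, K]] has evident
    continuity. *)
Definition clamp (K x : R) : R := (Rabs (x + K) - Rabs (x - K)) / 2.

Lemma clamp_id K x : Rabs x <= K -> clamp K x = x.
Proof.
  intros H. unfold clamp. apply Rabs_le_between in H.
  rewrite Rabs_pos_eq, Rabs_left1 by lra. lra.
Qed.

Lemma clamp_bound K x : 0 <= K -> Rabs (clamp K x) <= K.
Proof.
  intros HK. apply Rabs_le. unfold clamp.
  unfold Rabs; destruct (Rcase_abs (x + K)); destruct (Rcase_abs (x - K)); lra.
Qed.

Lemma continuous_clamp K x : continuous (clamp K) x.
Proof.
  unfold clamp. apply continuous_Rdiv; [|apply continuous_const|lra].
  apply continuous_Rminus; apply continuous_comp with (g := Rabs);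
    try apply continuous_Rabs.
  - apply continuous_Rplus; [apply continuous_id|apply continuous_const].
  - apply continuous_Rminus; [apply continuous_id|apply continuous_const].
Qed.

(** By the intermediate value theorem, a change from one multiple of [2 * PI] to
    another would pass through an odd multiple of [PI]. *)
Lemma discrete_constant (d : R -> R) :
  (forall t, 0 <= t <= 1 ->
    continuous d t /\ exists k : Z, d t = 2 * IZR k * PI) -> d 0 = d 1.
Proof.
  intros Hd.
  assert (Hz : forall t, 0 <= t <= 1 -> exists k : Z, d t = 2 * IZR k * PI)
    by (intros t Ht; apply Hd, Ht).
  set (r := fun t => clamp (1 / 2) (t - 1 / 2) + 1 / 2).
  assert (Hr : forall t, 0 <= t <= 1 -> r t = t).
  { intros t Ht. unfold r. rewrite clamp_id; [ring|]. apply Rabs_le; lra. }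
  assert (Hc : continuity (fun t => d (r t))).
  { intros t. apply continuity_pt_filterlim. apply (continuous_comp r d).
    - apply continuous_Rplus; [|apply continuous_const].
      apply continuous_comp with (g := clamp (1 / 2)); [|apply continuous_clamp].
      apply continuous_Rminus; [apply continuous_id|apply continuous_const].
    - apply Hd. unfold r.
      generalize (clamp_bound (1 / 2) (t - 1 / 2) ltac:(lra)).
      intros H. apply Rabs_le_between in H. lra. }
  destruct (Hz 0) as [k0 H0]; [lra|]. destruct (Hz 1) as [k1 H1]; [lra|].
  assert (HP := PI_RGT_0).
  assert (Hmid : forall c : Z, (c = 1 \/ c = -1)%Z ->
    Rmin (d 0) (d 1) <= 2 * IZR k0 * PI + IZR c * PI <= Rmax (d 0) (d 1) -> False).
  { intros c Hc1 Hb.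
    destruct (IVT_gen (fun t => d (r t)) 0 1 (2 * IZR k0 * PI + IZR c * PI))
      as [t [Ht Hdt]].
    - exact Hc.
    - rewrite !Hr by lra. exact Hb.
    - rewrite Rmin_left, Rmax_right in Ht by lra.
      destruct (Hz t Ht) as [k Hk]. rewrite Hr, Hk in Hdt by exact Ht.
      assert (He : IZR (2 * k) = IZR (2 * k0 + c)).
      { rewrite plus_IZR, !mult_IZR. apply Rmult_eq_reg_r with PI; lra. }
      apply eq_IZR in He. lia. }
  destruct (Z.lt_trichotomy k0 k1) as [Hk|[Hk|Hk]].
  - exfalso. apply (Hmid 1%Z); [lia|].
    assert (Hle : IZR (k0 + 1) <= IZR k1) by (apply IZR_le; lia).
    rewrite plus_IZR in Hle.
    rewrite H0, H1, Rmin_left, Rmax_right by nra. nra.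
  - congruence.
  - exfalso. apply (Hmid (-1)%Z); [lia|].
    assert (Hle : IZR (k1 + 1) <= IZR k0) by (apply IZR_le; lia).
    rewrite plus_IZR in Hle.
    rewrite H0, H1, Rmin_right, Rmax_left by nra. nra.
Qed.

Lemma continuous_ray (v : R * R -> R) (x y t : R) :
  (forall p, continuous v p) -> continuous (fun t => v (t * x, t * y)) t.
Proof.
  intros Hv. apply (continuous_comp (fun t => (t * x, t * y)) v); [|apply Hv].
  apply (continuous_pair (U := R_UniformSpace) (V := R_UniformSpace));
    apply continuous_Rmult;
    first [apply continuous_id | apply continuous_const].
Qed.

Definition in_square (K : R) (p : R * R) : Prop :=
  Rabs (fst p) <= K /\ Rabs (snd p) <= K.

Lemma in_square_scal K t x y :
  0 <= t <= 1 -> in_square K (x, y) -> in_square K (t * x, t * y).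
Proof.
  intros Ht [Hx Hy]. unfold in_square in *; simpl fst in *; simpl snd in *.
  rewrite !Rabs_mult, (Rabs_pos_eq t) by lra.
  generalize (Rabs_pos x) (Rabs_pos y). nra.
Qed.

(** The difference of the two arguments is constant along each ray from the
    origin. *)
Lemma arguments_agree (G : R * R -> C_UniformSpace) (v w : R * R -> R) (K : R) :
  (forall p, continuous v p) -> (forall p, continuous w p) ->
  v (0, 0) = w (0, 0) ->
  (forall p, in_square K p ->
    0 < Cmod (G p) /\ is_argument (G p) (v p) /\ is_argument (G p) (w p)) ->
  forall p, in_square K p -> v p = w p.
Proof.
  intros Hv Hw H0 HG [x y] Hp.
  pose proof (discrete_constant (fun t => w (t * x, t * y) - v (t * x, t * y))) as H.
  simpl in H. rewrite !Rmult_0_l, !Rmult_1_l in H.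
  assert (w (0, 0) - v (0, 0) = w (x, y) - v (x, y)); [|lra].
  apply H. intros t Ht. split.
  - apply continuous_Rminus; apply continuous_ray; assumption.
  - destruct (HG (t * x, t * y)) as [Hn [Ha Hb]];
      [apply in_square_scal; assumption|].
    apply (argument_differ (G (t * x, t * y))); assumption.
Qed.

(** Each point has a neighbourhood on which any two values of [G] make an acute
    angle; a Lebesgue number of this covering of the square is the required
    [d]. *)
Lemma uniform_dot_pos (G : R * R -> C_UniformSpace) (K : R) :
  (forall p, continuous G p) -> (forall p, 0 < Cmod (G p)) ->
  exists d : posreal, forall x y x' y',
    in_square K (x, y) ->
    Rabs (x' - x) < d -> Rabs (y' - y) < d -> 0 < dot (G (x, y)) (G (x', y')).
Proof.
  intros Hc Hn.
  assert (Hloc : forall u v : R, exists e : posreal, forall x y x' y',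
    Rabs (x - u) < 2 * e -> Rabs (y - v) < 2 * e ->
    Rabs (x' - u) < 2 * e -> Rabs (y' - v) < 2 * e ->
    0 < dot (G (x, y)) (G (x', y'))).
  { intros u v.
    set (p0 := ((u, v), (u, v)) : prod_UniformSpace
      (prod_UniformSpace R_UniformSpace R_UniformSpace)
      (prod_UniformSpace R_UniformSpace R_UniformSpace)).
    destruct (locally_lt (fun _ => 0) (fun pq => dot (G (fst pq)) (G (snd pq))) p0)
      as [e He].
    - apply continuous_const.
    - apply continuous_dot.
      + apply (continuous_comp fst G); [apply continuous_fst|apply Hc].
      + apply (continuous_comp snd G); [apply continuous_snd|apply Hc].
    - simpl. unfold dot. rewrite <- Cmod_sqr.
      apply Rmult_lt_0_compat; apply Hn.
    - assert (He2 : 0 < e / 2) by (generalize (cond_pos e); lra).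
      exists (mkposreal _ He2). simpl. intros x y x' y' H1 H2 H3 H4.
      apply (He ((x, y), (x', y'))).
      repeat split; simpl; unfold ball; simpl; unfold AbsRing_ball, abs, minus, plus, opp;
        simpl; match goal with H : Rabs (?a - ?b) < _ |- Rabs (?a + - ?b) < _ =>
          unfold Rminus in H; lra end. }
  set (delta := fun u v => proj1_sig (constructive_indefinite_description _ (Hloc u v))).
  assert (Hdelta : forall u v x y x' y',
    Rabs (x - u) < 2 * delta u v -> Rabs (y - v) < 2 * delta u v ->
    Rabs (x' - u) < 2 * delta u v -> Rabs (y' - v) < 2 * delta u v ->
    0 < dot (G (x, y)) (G (x', y'))).
  { intros u v.
    exact (proj2_sig (constructive_indefinite_description _ (Hloc u v))). }
  destruct (compactness_value_2d (-K) K (-K) K delta) as [d Hd].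
  exists d. intros x y x' y' [Hx Hy] Hx' Hy'. simpl in Hx, Hy.
  apply NNPP. intros Hneg.
  apply (Hd x y); try (apply Rabs_le_between; assumption).
  intros [u [v [_ [_ [Hxu [Hyv Hdd]]]]]]. apply Hneg.
  assert (0 < d) by apply cond_pos.
  assert (forall a b c, Rabs (b - a) < d -> Rabs (a - c) < delta u v ->
    Rabs (b - c) < 2 * delta u v) as Htri.
  { intros a b c H1 H2. replace (b - c) with ((b - a) + (a - c)) by ring.
    eapply Rle_lt_trans; [apply Rabs_triang|lra]. }
  apply (Hdelta u v); try lra; eapply Htri; eassumption.
Qed.

(** Shrinking the square to its centre in [N] small steps joins the given map to
    a constant through maps each of which makes an acute angle with the next. *)
Lemma square_argument (G : R * R -> C_UniformSpace) (K : R) :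
  0 <= K -> (forall p, continuous G p) -> (forall p, 0 < Cmod (G p)) ->
  exists v : R * R -> R, (forall p, continuous v p) /\
    forall p, in_square K p -> is_argument (G p) (v p).
Proof.
  intros HK Hc Hn.
  destruct (uniform_dot_pos G K Hc Hn) as [d Hd].
  destruct (nfloor_ex (K / d)) as [n Hfl].
  { apply Rdiv_le_0_compat; [exact HK|apply cond_pos]. }
  (* With [N] steps, no coordinate moves by more than [K / N < d] in a step. *)
  set (N := INR n + 1).
  assert (HN : 0 < N) by (unfold N; generalize (pos_INR n); lra).
  assert (HKN : K / N < d).
  { assert (Hd0 := cond_pos d). apply Rmult_lt_reg_r with (N / d).
    - apply Rdiv_lt_0_compat; assumption.
    - replace (K / N * (N / d)) with (K / d) by (field; lra).
      replace (d * (N / d)) with N by (field; lra). unfold N; lra. }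
  set (g := fun (k : nat) (p : R * R) =>
    G (INR k / N * clamp K (fst p), INR k / N * clamp K (snd p))).
  assert (Hg : forall k p, continuous (g k) p).
  { intros k p. unfold g.
    apply (continuous_comp (fun p : R * R =>
      (INR k / N * clamp K (fst p), INR k / N * clamp K (snd p))) G); [|apply Hc].
    apply (continuous_pair (U := R_UniformSpace) (V := R_UniformSpace));
      (apply continuous_Rmult; [apply continuous_const|]);
      (apply continuous_comp with (g := clamp K); [|apply continuous_clamp]).
    - destruct p; apply continuous_fst.
    - destruct p; apply continuous_snd. }
  assert (Hsq : forall k p, (k <= S n)%nat ->
    in_square K (INR k / N * clamp K (fst p), INR k / N * clamp K (snd p))).
  { intros k p Hk. apply in_square_scal.
    - apply le_INR in Hk. rewrite S_INR in Hk. fold N in Hk.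
      split; [apply Rdiv_le_0_compat; [apply pos_INR|exact HN]|].
      apply Rmult_le_reg_r with N; [exact HN|].
      replace (INR k / N * N) with (INR k) by (field; lra). lra.
    - split; apply clamp_bound, HK. }
  assert (Hstep : forall k x, Rabs (INR (S k) / N * clamp K x - INR k / N * clamp K x) < d).
  { intros k x. rewrite S_INR.
    replace ((INR k + 1) / N * clamp K x - INR k / N * clamp K x)
      with (clamp K x * / N) by (field; lra).
    rewrite Rabs_mult, (Rabs_pos_eq (/ N)) by (apply Rlt_le, Rinv_0_lt_compat, HN).
    eapply Rle_lt_trans; [|exact HKN].
    apply Rmult_le_compat_r; [apply Rlt_le, Rinv_0_lt_compat, HN|].
    apply clamp_bound, HK. }
  assert (Hall : forall k, (k <= S n)%nat -> exists v, continuous_argument (g k) v).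
  { induction k as [|k IH]; intros Hk.
    - destruct (argument_exists (G (0, 0))) as [t Ht]. exists (fun _ => t).
      intros p. split; [apply continuous_const|].
      unfold g. simpl INR. unfold Rdiv. rewrite !Rmult_0_l. exact Ht.
    - apply continuous_argument_step with (g k); auto.
      + intros p. unfold g. apply Hd; auto. apply Hsq; lia.
      + apply IH; lia. }
  destruct (Hall (S n)) as [v Hv]; [lia|].
  exists v. split; [intros p; apply Hv|].
  intros [x y] [Hx Hy]. destruct (Hv (x, y)) as [_ Ha].
  unfold g in Ha. simpl fst in *; simpl snd in *.
  rewrite S_INR in Ha. fold N in Ha.
  rewrite !clamp_id in Ha by assumption.
  replace (N / N) with 1 in Ha by (field; lra).
  rewrite !Rmult_1_l in Ha. exact Ha.
Qed.

(** Arguments on larger and larger squares, all with the same value at the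
    origin, agree where they are both defined, so they fit together. *)
Lemma plane_argument (G : R * R -> C_UniformSpace) :
  (forall p, continuous G p) -> (forall p, 0 < Cmod (G p)) ->
  exists v : R * R -> R, continuous_argument G v.
Proof.
  intros Hc Hn.
  destruct (argument_exists (G (0, 0))) as [t0 Ht0].
  assert (Hex : forall K, exists v : R * R -> R, 0 <= K ->
    (forall p, continuous v p) /\ v (0, 0) = t0 /\
    forall p, in_square K p -> is_argument (G p) (v p)).
  { intros K. destruct (Rle_dec 0 K) as [HK|HK]; [|exists (fun _ => 0); lra].
    destruct (square_argument G K HK Hc Hn) as [v [Hv Ha]].
    assert (H00 : in_square K (0, 0)).
    { split; simpl; rewrite Rabs_R0; exact HK. }
    exists (fun p => v p + (t0 - v (0, 0))). intros _. repeat split.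
    - intros p. apply continuous_Rplus; [apply Hv|apply continuous_const].
    - ring.
    - intros p Hp.
      destruct (argument_differ (G (0, 0)) (v (0, 0)) t0) as [k Hk]; auto.
      rewrite Hk. apply argument_shift, Ha, Hp. }
  set (v := fun K => proj1_sig (constructive_indefinite_description _ (Hex K))).
  assert (Hv : forall K, 0 <= K ->
    (forall p, continuous (v K) p) /\ v K (0, 0) = t0 /\
    forall p, in_square K p -> is_argument (G p) (v K p)).
  { intros K. exact (proj2_sig (constructive_indefinite_description _ (Hex K))). }
  set (size := fun p : R * R => Rabs (fst p) + Rabs (snd p)).
  assert (Hsize : forall p, 0 <= size p).
  { intros p. unfold size. generalize (Rabs_pos (fst p)) (Rabs_pos (snd p)); lra. }
  assert (Hin : forall K p, size p <= K -> in_square K p).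
  { intros K p. unfold size, in_square.
    generalize (Rabs_pos (fst p)) (Rabs_pos (snd p)); lra. }
  assert (Hagree : forall K p, size p <= K -> v (size p) p = v K p).
  { intros K p HK.
    assert (HK0 : 0 <= K) by (generalize (Hsize p); lra).
    destruct (Hv _ (Hsize p)) as [Hc1 [H01 Ha1]].
    destruct (Hv _ HK0) as [Hc2 [H02 Ha2]].
    apply (arguments_agree G _ _ (size p)); auto; [congruence| |apply Hin; lra].
    intros q Hq. split; [apply Hn|]. split; [auto|].
    apply Ha2. destruct Hq; split; lra. }
  (* The square used varies with the point, but near [p] the square of half-side
     [size p + 1] serves for all points. *)
  exists (fun p => v (size p) p). intros p. split.
  - apply continuous_ext_loc with (v (size p + 1)).
    + assert (Hcs : continuous size p).
      { unfold size. apply continuous_Rplus;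
          apply continuous_comp with (g := Rabs); try apply continuous_Rabs;
          destruct p; [apply continuous_fst|apply continuous_snd]. }
      generalize (locally_lt size (fun _ => size p + 1) p Hcs
        (continuous_const _ _) ltac:(lra)).
      apply filter_imp. intros q Hq. symmetry. apply Hagree. lra.
    + apply Hv. generalize (Hsize p); lra.
  - apply Hv; [apply Hsize|apply Hin; lra].
Qed.

(** * Flux through the boundary of a rectangle *)

Lemma nested_intervals (a b : nat -> R) :
  (forall n, a n <= a (S n)) -> (forall n, b (S n) <= b n) ->
  (forall n, a n <= b n) -> exists x, forall n, a n <= x <= b n.
Proof.
  intros Ha Hb Hab.
  assert (Ham : forall n k, a n <= a (k + n)%nat).
  { intros n k. induction k; simpl; [lra|].
    eapply Rle_trans; [exact IHk|apply Ha]. }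
  assert (Hbm : forall n k, b (k + n)%nat <= b n).
  { intros n k. induction k; simpl; [lra|].
    eapply Rle_trans; [apply Hb|exact IHk]. }
  assert (Hub : forall n m, a m <= b n).
  { intros n m. destruct (Nat.le_ge_cases m n) as [H|H].
    - replace n with (n - m + m)%nat by lia.
      eapply Rle_trans; [apply (Ham m (n - m)%nat)|apply Hab].
    - replace m with (m - n + n)%nat by lia.
      eapply Rle_trans; [apply Hab|apply Hbm]. }
  destruct (completeness (fun r => exists n, r = a n)) as [x [Hx1 Hx2]].
  - exists (b 0%nat). intros r [n ->]. apply Hub.
  - exists (a 0%nat), 0%nat. reflexivity.
  - exists x. intros n. split.
    + apply Hx1. exists n; reflexivity.
    + apply Hx2. intros r [m ->]. apply Hub.
Qed.

Lemma section_x_continuous (u : R -> R -> R) x y a b :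
  differentiable_pt_lim u x y a b -> continuous (fun t => u t y) x.
Proof.
  intros H. apply continuity_pt_filterlim, derivable_continuous_pt.
  exists (a * 1 + b * 0).
  apply (derivable_pt_lim_comp_2d u (fun t => t) (fun _ => y)); auto.
  - apply derivable_pt_lim_id.
  - apply derivable_pt_lim_const.
Qed.

Lemma section_y_continuous (u : R -> R -> R) x y a b :
  differentiable_pt_lim u x y a b -> continuous (fun t => u x t) y.
Proof.
  intros H. apply continuity_pt_filterlim, derivable_continuous_pt.
  exists (a * 0 + b * 1).
  apply (derivable_pt_lim_comp_2d u (fun _ => x) (fun t => t)); auto.
  - apply derivable_pt_lim_const.
  - apply derivable_pt_lim_id.
Qed.

Lemma RInt_difference_bound (f g : R -> R) a b c M :
  a <= b -> ex_RInt f a b -> ex_RInt g a b ->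
  (forall t, a <= t <= b -> Rabs (f t - g t - c) <= M) ->
  Rabs (RInt f a b - RInt g a b - c * (b - a)) <= M * (b - a).
Proof.
  intros Hab Hf Hg HM.
  assert (Hfg : ex_RInt (fun t => f t - g t) a b)
    by exact (ex_RInt_minus f g a b Hf Hg).
  assert (Hc : ex_RInt (fun _ => c) a b) by apply ex_RInt_const.
  assert (H1 : RInt (fun t => f t - g t - c) a b
    = RInt f a b - RInt g a b - c * (b - a)).
  { transitivity (RInt (fun t => f t - g t) a b - RInt (fun _ => c) a b).
    - exact (RInt_minus (fun t => f t - g t) (fun _ => c) a b Hfg Hc).
    - rewrite RInt_const. unfold scal; simpl; unfold mult; simpl.
      rewrite (Rmult_comm (b - a)). f_equal. exact (RInt_minus f g a b Hf Hg). }
  rewrite <- H1, Rmult_comm. apply abs_RInt_le_const; auto.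
  exact (ex_RInt_minus (fun t => f t - g t) (fun _ => c) a b Hfg Hc).
Qed.

(** The outward flux of the field [(u, -v)], which is also the imaginary part of
    the contour integral of [u + i v]. *)
Definition flux (u v : R -> R -> R) (x1 x2 y1 y2 : R) : R :=
  (RInt (fun y => u x2 y) y1 y2 - RInt (fun y => u x1 y) y1 y2)
  - (RInt (fun x => v x y2) x1 x2 - RInt (fun x => v x y1) x1 x2).

(** The condition that the field [(u, -v)] have zero divergence at a point,
    in the sense of total differentiability only. *)
Definition divergence_free (u v : R -> R -> R) (x y : R) : Prop :=
  exists a b c, differentiable_pt_lim u x y a b /\ differentiable_pt_lim v x y c a.

Section Flux.
Variables (u v : R -> R -> R) (x1 x2 y1 y2 : R).
Hypothesis div0 :
  forall x y, x1 <= x <= x2 -> y1 <= y <= y2 -> divergence_free u v x y.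

Lemma ex_RInt_u x a b :
  x1 <= x <= x2 -> y1 <= a -> a <= b -> b <= y2 -> ex_RInt (fun y => u x y) a b.
Proof.
  intros Hx Ha Hab Hb. apply (ex_RInt_continuous (fun y => u x y)). intros y.
  rewrite Rmin_left, Rmax_right by exact Hab. intros Hy.
  destruct (div0 x y) as (p & q & r & H & _); [lra|lra|].
  exact (section_y_continuous _ _ _ _ _ H).
Qed.

Lemma ex_RInt_v y a b :
  y1 <= y <= y2 -> x1 <= a -> a <= b -> b <= x2 -> ex_RInt (fun x => v x y) a b.
Proof.
  intros Hx Ha Hab Hb. apply (ex_RInt_continuous (fun x => v x y)). intros x.
  rewrite Rmin_left, Rmax_right by exact Hab. intros Hy.
  destruct (div0 x y) as (p & q & r & _ & H); [lra|lra|].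
  exact (section_x_continuous _ _ _ _ _ H).
Qed.

Lemma flux_quarters xa xm xb ya ym yb :
  x1 <= xa -> xa <= xm -> xm <= xb -> xb <= x2 ->
  y1 <= ya -> ya <= ym -> ym <= yb -> yb <= y2 ->
  flux u v xa xb ya yb =
    flux u v xa xm ya ym + flux u v xm xb ya ym
    + (flux u v xa xm ym yb + flux u v xm xb ym yb).
Proof.
  intros. unfold flux.
  assert (Hu : forall x, x1 <= x <= x2 -> RInt (fun y => u x y) ya yb
    = RInt (fun y => u x y) ya ym + RInt (fun y => u x y) ym yb).
  { intros x Hx. symmetry.
    apply (RInt_Chasles (fun y => u x y)); apply ex_RInt_u; lra. }
  assert (Hv : forall y, y1 <= y <= y2 -> RInt (fun x => v x y) xa xb
    = RInt (fun x => v x y) xa xm + RInt (fun x => v x y) xm xb).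
  { intros y Hy. symmetry.
    apply (RInt_Chasles (fun x => v x y)); apply ex_RInt_v; lra. }
  rewrite !Hu, !Hv by lra. ring.
Qed.

(** On a small rectangle the affine parts of [u] and [v] contribute opposite
    multiples of the area, and only the errors remain. *)
Lemma flux_local x0 y0 (eps : posreal) :
  x1 <= x0 <= x2 -> y1 <= y0 <= y2 ->
  exists delta : posreal, forall x w y h,
    0 <= w -> 0 <= h -> w + h < delta ->
    x1 <= x <= x0 -> x0 <= x + w <= x2 -> y1 <= y <= y0 -> y0 <= y + h <= y2 ->
    Rabs (flux u v x (x + w) y (y + h)) <= 2 * eps * (w + h) ^ 2.
Proof.
  intros Hx0 Hy0.
  destruct (div0 x0 y0 Hx0 Hy0) as (a & b & c & Hu & Hv).
  destruct (Hu eps) as [d1 H1]. destruct (Hv eps) as [d2 H2].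
  assert (Hd : 0 < Rmin d1 d2) by (apply Rmin_pos; apply cond_pos).
  exists (mkposreal _ Hd). simpl. intros x w y h Hw Hh Hwh Hx Hxw Hy Hyh.
  assert (Hwh1 : w + h < d1) by (eapply Rlt_le_trans; [exact Hwh|apply Rmin_l]).
  assert (Hwh2 : w + h < d2) by (eapply Rlt_le_trans; [exact Hwh|apply Rmin_r]).
  assert (Heps := cond_pos eps).
  assert (Hnear : forall s t, x <= s <= x + w -> y <= t <= y + h ->
    Rabs (s - x0) <= w /\ Rabs (t - y0) <= h /\
    Rmax (Rabs (s - x0)) (Rabs (t - y0)) <= w + h).
  { intros s t Hs Ht.
    assert (Rabs (s - x0) <= w) by (apply Rabs_le; lra).
    assert (Rabs (t - y0) <= h) by (apply Rabs_le; lra).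
    repeat split; auto. apply Rmax_lub; lra. }
  assert (Hue : forall s t, x <= s <= x + w -> y <= t <= y + h ->
    Rabs (u s t - u x0 y0 - (a * (s - x0) + b * (t - y0))) <= eps * (w + h)).
  { intros s t Hs Ht. destruct (Hnear s t Hs Ht) as (N1 & N2 & N3).
    eapply Rle_trans; [apply H1; lra|]. apply Rmult_le_compat_l; lra. }
  assert (Hve : forall s t, x <= s <= x + w -> y <= t <= y + h ->
    Rabs (v s t - v x0 y0 - (c * (s - x0) + a * (t - y0))) <= eps * (w + h)).
  { intros s t Hs Ht. destruct (Hnear s t Hs Ht) as (N1 & N2 & N3).
    eapply Rle_trans; [apply H2; lra|]. apply Rmult_le_compat_l; lra. }
  assert (Iu : Rabs (RInt (fun t => u (x + w) t) y (y + h) - RInt (fun t => u x t) y (y + h)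
      - a * w * (y + h - y)) <= 2 * eps * (w + h) * (y + h - y)).
  { apply RInt_difference_bound; [lra|apply ex_RInt_u; lra|apply ex_RInt_u; lra|].
    intros t Ht.
    generalize (Hue (x + w) t ltac:(lra) Ht) (Hue x t ltac:(lra) Ht).
    intros E1 E2. apply Rabs_le_between in E1. apply Rabs_le_between in E2.
    apply Rabs_le. split; nra. }
  assert (Iv : Rabs (RInt (fun s => v s (y + h)) x (x + w) - RInt (fun s => v s y) x (x + w)
      - a * h * (x + w - x)) <= 2 * eps * (w + h) * (x + w - x)).
  { apply RInt_difference_bound; [lra|apply ex_RInt_v; lra|apply ex_RInt_v; lra|].
    intros s Hs.
    generalize (Hve s (y + h) Hs ltac:(lra)) (Hve s y Hs ltac:(lra)).
    intros E1 E2. apply Rabs_le_between in E1. apply Rabs_le_between in E2.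
    apply Rabs_le. split; nra. }
  unfold flux. apply Rabs_le_between in Iu. apply Rabs_le_between in Iv.
  apply Rabs_le. split; nra.
Qed.

(** Bisection: the bound is additive under division into four quarters, so a
    rectangle violating it would contain a nested sequence of such rectangles,
    against [flux_local] at their common point. *)
Lemma flux_le (eps : posreal) : x1 <= x2 -> y1 <= y2 ->
  Rabs (flux u v x1 x2 y1 y2) <= 2 * eps * ((x2 - x1) + (y2 - y1)) ^ 2.
Proof.
  intros Hx Hy. apply Rnot_lt_le. intros Hbad.
  set (s := fun n => (1 / 2) ^ n).
  assert (Hs : forall n, 0 < s n) by (intros n; apply pow_lt; lra).
  assert (HsS : forall n, s (S n) = s n / 2) by (intros n; unfold s; simpl; field).
  set (w := fun n => (x2 - x1) * s n). set (h := fun n => (y2 - y1) * s n).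
  assert (Hw : forall n, 0 <= w n) by (intros n; unfold w; specialize (Hs n); nra).
  assert (Hh : forall n, 0 <= h n) by (intros n; unfold h; specialize (Hs n); nra).
  assert (HwS : forall n, w n = w (S n) + w (S n)) by (intros n; unfold w; rewrite HsS; field).
  assert (HhS : forall n, h n = h (S n) + h (S n)) by (intros n; unfold h; rewrite HsS; field).
  set (bad := fun n (p : R * R) =>
    x1 <= fst p /\ fst p + w n <= x2 /\ y1 <= snd p /\ snd p + h n <= y2 /\
    2 * eps * (w n + h n) ^ 2
      < Rabs (flux u v (fst p) (fst p + w n) (snd p) (snd p + h n))).
  set (inside := fun n (p q : R * R) =>
    fst p <= fst q /\ fst q + w (S n) <= fst p + w n /\
    snd p <= snd q /\ snd q + h (S n) <= snd p + h n).
  assert (Hstep : forall n p, exists q, bad n p -> bad (S n) q /\ inside n p q).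
  { intros n [x y].
    destruct (classic (bad n (x, y))) as [Hb|Hb]; [|exists (x, y); tauto].
    destruct Hb as (B1 & B2 & B3 & B4 & B5). simpl in *.
    apply NNPP. intros Hno.
    assert (Hq : forall x' y', inside n (x, y) (x', y') ->
      Rabs (flux u v x' (x' + w (S n)) y' (y' + h (S n)))
        <= 2 * eps * (w (S n) + h (S n)) ^ 2).
    { intros x' y' Hi. apply Rnot_lt_le. intros Hlt. apply Hno.
      exists (x', y'). intros _. split; [|exact Hi].
      destruct Hi as (I1 & I2 & I3 & I4). simpl in *.
      unfold bad; simpl. repeat split; try lra; exact Hlt. }
    specialize (Hw (S n)). specialize (Hh (S n)).
    rewrite (HwS n) in B2. rewrite (HhS n) in B4. rewrite (HwS n), (HhS n) in B5.
    rewrite (flux_quarters x (x + w (S n)) (x + (w (S n) + w (S n)))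
      y (y + h (S n)) (y + (h (S n) + h (S n)))) in B5 by lra.
    rewrite <- !Rplus_assoc in B5.
    assert (Q1 := Hq x y). assert (Q2 := Hq (x + w (S n)) y).
    assert (Q3 := Hq x (y + h (S n))). assert (Q4 := Hq (x + w (S n)) (y + h (S n))).
    unfold inside in Q1, Q2, Q3, Q4; simpl fst in *; simpl snd in *.
    rewrite (HwS n), (HhS n) in Q1, Q2, Q3, Q4.
    specialize (Q1 ltac:(lra)). specialize (Q2 ltac:(lra)).
    specialize (Q3 ltac:(lra)). specialize (Q4 ltac:(lra)).
    apply Rabs_le_between in Q1. apply Rabs_le_between in Q2.
    apply Rabs_le_between in Q3. apply Rabs_le_between in Q4.
    apply (Rlt_not_le _ _ B5). apply Rabs_le.
    replace (2 * eps * (w (S n) + w (S n) + h (S n) + h (S n)) ^ 2)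
      with (4 * (2 * eps * (w (S n) + h (S n)) ^ 2)) by ring.
    lra. }
  set (next := fun n p => proj1_sig (constructive_indefinite_description _ (Hstep n p))).
  assert (Hnext : forall n p, bad n p -> bad (S n) (next n p) /\ inside n p (next n p)).
  { intros n p. exact (proj2_sig (constructive_indefinite_description _ (Hstep n p))). }
  set (c := fix c n := match n with O => (x1, y1) | S m => next m (c m) end).
  assert (Hc : forall n, bad n (c n)).
  { induction n as [|n IH]; [|exact (proj1 (Hnext n (c n) IH))].
    unfold bad, w, h, s; simpl. rewrite !Rmult_1_r.
    replace (x1 + (x2 - x1)) with x2 by ring. replace (y1 + (y2 - y1)) with y2 by ring.
    simpl in Hbad. repeat split; lra. }
  assert (Hin : forall n, inside n (c n) (c (S n))).
  { intros n. exact (proj2 (Hnext n (c n) (Hc n))). }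
  destruct (nested_intervals (fun n => fst (c n)) (fun n => fst (c n) + w n)) as [x0 Hx0];
    try (intros n; destruct (Hin n) as (I1 & I2 & I3 & I4); specialize (Hw n); lra).
  destruct (nested_intervals (fun n => snd (c n)) (fun n => snd (c n) + h n)) as [y0 Hy0];
    try (intros n; destruct (Hin n) as (I1 & I2 & I3 & I4); specialize (Hh n); lra).
  assert (Hx0' : x1 <= x0 <= x2).
  { destruct (Hc 0%nat) as (B1 & B2 & _). specialize (Hx0 0%nat). lra. }
  assert (Hy0' : y1 <= y0 <= y2).
  { destruct (Hc 0%nat) as (_ & _ & B1 & B2 & _). specialize (Hy0 0%nat). lra. }
  destruct (flux_local x0 y0 eps Hx0' Hy0') as [d Hd].
  assert (Hd0 := cond_pos d).
  assert (HL : 0 < (x2 - x1) + (y2 - y1) + 1) by lra.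
  destruct (pow_lt_1_zero (1 / 2)) with (y := d / ((x2 - x1) + (y2 - y1) + 1)) as [n Hn].
  { rewrite Rabs_pos_eq; lra. }
  { apply Rdiv_lt_0_compat; lra. }
  specialize (Hn n (le_n n)). fold (s n) in Hn.
  rewrite Rabs_pos_eq in Hn by (apply Rlt_le, Hs).
  assert (Hwh : w n + h n < d).
  { apply Rmult_lt_compat_r with (r := (x2 - x1) + (y2 - y1) + 1) in Hn; [|lra].
    unfold Rdiv in Hn. rewrite Rmult_assoc, Rinv_l, Rmult_1_r in Hn by lra.
    unfold w, h. specialize (Hs n). nra. }
  destruct (Hc n) as (B1 & B2 & B3 & B4 & B5).
  specialize (Hx0 n). specialize (Hy0 n).
  apply (Rlt_not_le _ _ B5). apply Hd; auto; lra.
Qed.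

Theorem flux_zero : x1 <= x2 -> y1 <= y2 -> flux u v x1 x2 y1 y2 = 0.
Proof.
  intros Hx Hy. set (L := 2 * ((x2 - x1) + (y2 - y1)) ^ 2 + 1).
  assert (HL : 0 < L) by (unfold L; generalize (pow2_ge_0 ((x2 - x1) + (y2 - y1))); lra).
  destruct (Req_dec (flux u v x1 x2 y1 y2) 0) as [H|H]; [exact H|exfalso].
  apply Rabs_pos_lt in H.
  assert (He : 0 < Rabs (flux u v x1 x2 y1 y2) / L) by (apply Rdiv_lt_0_compat; assumption).
  generalize (flux_le (mkposreal _ He) Hx Hy). simpl pos.
  set (F := Rabs (flux u v x1 x2 y1 y2)) in *.
  replace (2 * (F / L) * (x2 - x1 + (y2 - y1)) ^ 2) with (F / L * (L - 1))
    by (unfold L; field; fold L; lra).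
  replace (F / L * (L - 1)) with (F - F / L) by (field; lra). lra.
Qed.

End Flux.

(** * Total differentiability of the logarithm of a holomorphic map *)

Lemma differentiable_eq (f : R -> R -> R) x y a b a' b' :
  differentiable_pt_lim f x y a b -> a = a' -> b = b' ->
  differentiable_pt_lim f x y a' b'.
Proof. intros H <- <-. exact H. Qed.

Lemma differentiable_affine k l c x y :
  differentiable_pt_lim (fun s t => k * s + l * t + c) x y k l.
Proof.
  intros eps. exists (mkposreal _ Rlt_0_1). intros s t _ _.
  match goal with |- Rabs ?e <= _ => replace e with 0 by ring end.
  rewrite Rabs_R0. apply Rmult_le_pos; [apply Rlt_le, cond_pos|].
  eapply Rle_trans; [apply Rabs_pos|apply Rmax_l].
Qed.

Lemma differentiable_snd x y : differentiable_pt_lim (fun _ t => t) x y 0 1.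
Proof.
  apply (differentiable_pt_lim_ext (fun s t => 0 * s + 1 * t + 0)).
  - exists (mkposreal _ Rlt_0_1). intros; ring.
  - apply differentiable_affine.
Qed.

Lemma differentiable_mult (f g : R -> R -> R) x y a b c d :
  differentiable_pt_lim f x y a b -> differentiable_pt_lim g x y c d ->
  differentiable_pt_lim (fun s t => f s t * g s t) x y
    (g x y * a + f x y * c) (g x y * b + f x y * d).
Proof.
  intros Hf Hg.
  apply (differentiable_pt_lim_comp (fun s t => s * t) f g); [|exact Hf|exact Hg].
  intros eps. exists eps. intros s t Hs Ht.
  replace (s * t - f x y * g x y - (g x y * (s - f x y) + f x y * (t - g x y)))
    with ((s - f x y) * (t - g x y)) by ring.
  rewrite Rabs_mult. apply Rmult_le_compat; try apply Rabs_pos; [lra|apply Rmax_r].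
Qed.

Lemma differentiable_comp1 (h : R -> R) (f : R -> R -> R) x y l a b :
  derivable_pt_lim h (f x y) l -> differentiable_pt_lim f x y a b ->
  differentiable_pt_lim (fun s t => h (f s t)) x y (l * a) (l * b).
Proof.
  intros Hh Hf.
  eapply differentiable_eq.
  - apply (differentiable_pt_lim_comp (fun s _ => h s) f f).
    + apply differentiable_pt_lim_proj1_0, Hh.
    + exact Hf.
    + exact Hf.
  - ring.
  - ring.
Qed.

Lemma differentiable_lincomb k l (f g : R -> R -> R) x y a b c d :
  differentiable_pt_lim f x y a b -> differentiable_pt_lim g x y c d ->
  differentiable_pt_lim (fun s t => k * f s t + l * g s t) x y
    (k * a + l * c) (k * b + l * d).
Proof.
  intros Hf Hg.
  apply (differentiable_pt_lim_comp (fun s t => k * s + l * t) f g);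
    [|exact Hf|exact Hg].
  apply (differentiable_pt_lim_ext (fun s t => k * s + l * t + 0)).
  - exists (mkposreal _ Rlt_0_1). intros; ring.
  - apply differentiable_affine.
Qed.

(** Here [(a, b)] is the complex derivative of [f] as a function of [s + i t]. *)
Definition cauchy_riemann (f : R -> R -> C) (x y : R) : Prop :=
  exists a b,
    differentiable_pt_lim (fun s t => fst (f s t)) x y a (- b) /\
    differentiable_pt_lim (fun s t => snd (f s t)) x y b a.

Lemma ex_derive_cauchy_riemann (f : C -> C) (x y : R) :
  @ex_derive C_AbsRing C_NormedModule f (x, y) ->
  cauchy_riemann (fun s t => f (s, t)) x y.
Proof.
  intros [[a b] [_ H]]. specialize (H (x, y) (fun P HP => HP)).
  exists a, b.
  assert (Hs : 0 < sqrt 2) by (apply sqrt_lt_R0; lra).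
  assert (Hmain : forall eps : posreal, locally_2d (fun s t =>
    Cmod (f (s, t) - f (x, y) - ((s, t) - (x, y)) * (a, b))%C
      <= eps * Rmax (Rabs (s - x)) (Rabs (t - y))) x y).
  { intros eps.
    assert (He : 0 < eps / sqrt 2) by (apply Rdiv_lt_0_compat; [apply cond_pos|exact Hs]).
    specialize (H (mkposreal _ He)). apply locally_C in H.
    apply locally_2d_locally. revert H. apply filter_imp. intros [s t] Hst.
    simpl fst; simpl snd. eapply Rle_trans; [exact Hst|].
    change (eps / sqrt 2 * Cmod (s - x, t - y) <= eps * Rmax (Rabs (s - x)) (Rabs (t - y))).
    replace (eps * Rmax (Rabs (s - x)) (Rabs (t - y)))
      with (eps / sqrt 2 * (sqrt 2 * Rmax (Rabs (s - x)) (Rabs (t - y))))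
      by (field; lra).
    apply Rmult_le_compat_l; [lra|]. apply (Cmod_2Rmax (s - x, t - y)). }
  split; intros eps; destruct (Hmain eps) as [d Hd]; exists d; intros s t Hx Hy;
    (eapply Rle_trans; [|exact (Hd s t Hx Hy)]);
    (eapply Rle_trans; [|apply Rmax_Cmod]).
  - eapply Rle_trans; [|apply Rmax_l]. apply Req_le. f_equal. simpl. ring.
  - eapply Rle_trans; [|apply Rmax_r]. apply Req_le. f_equal. simpl. ring.
Qed.

Lemma cauchy_riemann_polar (f : C -> C) (x y : R) :
  @ex_derive C_AbsRing C_NormedModule f (polar (exp x) y) ->
  cauchy_riemann (fun s t => f (polar (exp s) t)) x y.
Proof.
  intros Hf. apply ex_derive_cauchy_riemann in Hf. destruct Hf as (a & b & H1 & H2).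
  assert (He : differentiable_pt_lim (fun s _ => exp s) x y (exp x) 0)
    by apply differentiable_pt_lim_proj1_0, derivable_pt_lim_exp.
  assert (Hc : differentiable_pt_lim (fun _ t => cos t) x y 0 (- sin y)).
  { eapply differentiable_eq.
    - apply (differentiable_comp1 cos (fun _ t => t)).
      + apply derivable_pt_lim_cos.
      + apply differentiable_snd.
    - ring.
    - ring. }
  assert (Hs : differentiable_pt_lim (fun _ t => sin t) x y 0 (cos y)).
  { eapply differentiable_eq.
    - apply (differentiable_comp1 sin (fun _ t => t)).
      + apply derivable_pt_lim_sin.
      + apply differentiable_snd.
    - ring.
    - ring. }
  assert (Hec := differentiable_mult _ _ _ _ _ _ _ _ He Hc).
  assert (Hes := differentiable_mult _ _ _ _ _ _ _ _ He Hs).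
  exists (exp x * (cos y * a - sin y * b)), (exp x * (sin y * a + cos y * b)). split.
  - eapply differentiable_eq;
      [apply (differentiable_pt_lim_comp (fun s t => fst (f (s, t))));
        [exact H1|exact Hec|exact Hes]|simpl; ring|simpl; ring].
  - eapply differentiable_eq;
      [apply (differentiable_pt_lim_comp (fun s t => snd (f (s, t))));
        [exact H2|exact Hec|exact Hes]|simpl; ring|simpl; ring].
Qed.

(** Near the point, the argument is its value there plus the turn, which is a
    differentiable function of the values of the map. *)
Lemma log_divergence_free (g : R -> R -> C) (v : R -> R -> R) (x y : R) :
  cauchy_riemann g x y -> 0 < Cmod (g x y) -> continuity_2d_pt v x y ->
  locally_2d (fun s t => 0 < Cmod (g s t) /\ is_argument (g s t) (v s t)) x y ->
  divergence_free (fun s t => ln (Cmod (g s t))) v x y.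
Proof.
  intros (a & b & H1 & H2) Hpos Hv Hloc.
  set (z := g x y) in *.
  assert (Hz : Cmod z * Cmod z = fst z * fst z + snd z * snd z) by apply Cmod_sqr.
  assert (Hz2 : 0 < fst z * fst z + snd z * snd z) by nra.
  assert (Hdot : differentiable_pt_lim (fun s t => dot z (g s t)) x y
    (fst z * a + snd z * b) (fst z * (- b) + snd z * a))
    by exact (differentiable_lincomb (fst z) (snd z) _ _ _ _ _ _ _ _ H1 H2).
  assert (Hcross : differentiable_pt_lim (fun s t => cross z (g s t)) x y
    (fst z * b - snd z * a) (fst z * a + snd z * b)).
  { apply (differentiable_pt_lim_ext
      (fun s t => (- snd z) * fst (g s t) + fst z * snd (g s t))).
    - exists (mkposreal _ Rlt_0_1). intros. unfold cross. ring.
    - eapply differentiable_eq;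
        [exact (differentiable_lincomb (- snd z) (fst z) _ _ _ _ _ _ _ _ H1 H2)
        |ring|ring]. }
  exists ((fst z * a + snd z * b) / (Cmod z * Cmod z)),
    ((fst z * (- b) + snd z * a) / (Cmod z * Cmod z)),
    ((fst z * b - snd z * a) / (Cmod z * Cmod z)).
  split.
  - assert (Hsq := differentiable_lincomb 1 1 _ _ _ _ _ _ _ _
      (differentiable_mult _ _ _ _ _ _ _ _ H1 H1)
      (differentiable_mult _ _ _ _ _ _ _ _ H2 H2)).
    assert (Hm : differentiable_pt_lim (fun s t => Cmod (g s t)) x y
      ((fst z * a + snd z * b) / Cmod z) ((fst z * (- b) + snd z * a) / Cmod z)).
    { apply (differentiable_pt_lim_ext (fun s t => sqrt
        (1 * (fst (g s t) * fst (g s t)) + 1 * (snd (g s t) * snd (g s t))))).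
      - exists (mkposreal _ Rlt_0_1). intros. unfold Cmod. f_equal. ring.
      - assert (Hr : sqrt (1 * (fst z * fst z) + 1 * (snd z * snd z)) = Cmod z)
          by (unfold Cmod; f_equal; ring).
        eapply differentiable_eq.
        + apply (differentiable_comp1 sqrt); [|exact Hsq].
          apply derivable_pt_lim_sqrt. fold z. lra.
        + cbv beta; fold z. rewrite Hr. field. lra.
        + cbv beta; fold z. rewrite Hr. field. lra. }
    eapply differentiable_eq.
    + apply (differentiable_comp1 ln); [|exact Hm].
      apply derivable_pt_lim_ln. exact Hpos.
    + fold z. field. lra.
    + fold z. field. lra.
  (* The constant is written as [v x y * 1] to fit [differentiable_lincomb]. *)
  - apply (differentiable_pt_lim_ext (fun s t =>
      1 * atan (cross z (g s t) * / dot z (g s t)) + v x y * 1)).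
    + destruct (Hv (mkposreal _ PI2_RGT_0)) as [d1 Hd1]. destruct Hloc as [d2 Hd2].
      assert (Hd : 0 < Rmin d1 d2) by (apply Rmin_pos; apply cond_pos).
      exists (mkposreal _ Hd). simpl. intros s t Hs Ht.
      assert (Hm1 := Rmin_l d1 d2). assert (Hm2 := Rmin_r d1 d2).
      destruct (Hd2 s t) as [Hgp Hga]; [lra|lra|].
      destruct (Hd2 x y) as [_ Hza];
        try (rewrite Rminus_diag, Rabs_R0; apply cond_pos).
      destruct (turn_difference z (g s t) (v x y) (v s t)) as [_ Ht2]; auto.
      { apply Hd1; lra. }
      change (atan (cross z (g s t) * / dot z (g s t))) with (turn z (g s t)).
      rewrite Ht2. ring.
    + assert (Hdz : dot z z = Cmod z * Cmod z) by (rewrite Hz; reflexivity).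
      assert (Hcz : cross z z = 0) by (unfold cross; ring).
      assert (Hinv := differentiable_comp1 Rinv (fun s t => dot z (g s t)) x y _ _ _
        (proj1 (is_derive_Reals Rinv (dot z z) _)
          (is_derive_inv (fun t => t) (dot z z) 1 (is_derive_id _) ltac:(nra))) Hdot).
      assert (Hq := differentiable_mult _ _ _ _ _ _ _ _ Hcross Hinv).
      assert (Ha := differentiable_comp1 atan _ _ _ _ _ _
        (derivable_pt_lim_atan _) Hq).
      cbv beta in Ha.
      assert (Hone : differentiable_pt_lim (fun _ _ => 1) x y 0 0).
      { apply (differentiable_pt_lim_ext (fun s t => 0 * s + 0 * t + 1)).
        - exists (mkposreal _ Rlt_0_1). intros; ring.
        - apply differentiable_affine. }
      eapply differentiable_eq;
        [exact (differentiable_lincomb 1 (v x y) _ _ _ _ _ _ _ _ Ha Hone)| |];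
        cbv beta; fold z; rewrite Hcz, Hdz; field; nra.
Qed.

(** * The period of the argument on a strip *)

Definition strip (a b : R) (p : R * R) : Prop := a < fst p < b.

(** The plane is carried onto the strip by a logistic function in the first
    coordinate. *)
Lemma strip_argument (G : R * R -> C_UniformSpace) (a b : R) :
  a < b -> (forall p, strip a b p -> continuous G p /\ 0 < Cmod (G p)) ->
  exists v : R * R -> R, forall p, strip a b p ->
    continuous v p /\ is_argument (G p) (v p).
Proof.
  intros Hab HG.
  set (phi := fun x => (a + b * exp x) / (1 + exp x)).
  set (psi := fun s => ln ((s - a) / (b - s))).
  assert (Hphi : forall x, a < phi x < b).
  { intros x. assert (He := exp_pos x).
    assert (H1 : phi x - a = (b - a) * exp x / (1 + exp x)) by (unfold phi; field; lra).
    assert (H2 : b - phi x = (b - a) / (1 + exp x)) by (unfold phi; field; lra).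
    assert (0 < (b - a) * exp x / (1 + exp x))
      by (apply Rdiv_lt_0_compat; [apply Rmult_lt_0_compat|]; lra).
    assert (0 < (b - a) / (1 + exp x)) by (apply Rdiv_lt_0_compat; lra).
    lra. }
  assert (Hpsi : forall s, a < s < b -> phi (psi s) = s).
  { intros s Hs. unfold phi, psi.
    rewrite exp_ln by (apply Rdiv_lt_0_compat; lra). field. split; lra. }
  destruct (plane_argument (fun p => G (phi (fst p), snd p))) as [w Hw].
  - intros p. apply (continuous_comp (fun p : R * R => (phi (fst p), snd p)) G);
      [|apply HG, Hphi].
    apply (continuous_pair (U := R_UniformSpace) (V := R_UniformSpace)).
    + apply continuous_comp with (g := phi); [destruct p; apply continuous_fst|].
      unfold phi. apply continuous_Rdiv.
      * apply continuous_Rplus; [apply continuous_const|].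
        apply continuous_Rmult; [apply continuous_const|apply continuous_exp].
      * apply continuous_Rplus; [apply continuous_const|apply continuous_exp].
      * apply Rgt_not_eq, Rplus_lt_0_compat; [lra|apply exp_pos].
    + destruct p; apply continuous_snd.
  - intros p. apply HG, Hphi.
  - exists (fun p => w (psi (fst p), snd p)). intros p Hp. split.
    + apply (continuous_comp (fun p : R * R => (psi (fst p), snd p)) w); [|apply Hw].
      apply (continuous_pair (U := R_UniformSpace) (V := R_UniformSpace)).
      * unfold strip in Hp.
        apply continuous_comp with (g := psi); [destruct p; apply continuous_fst|].
        unfold psi. apply (continuous_comp (fun s => (s - a) / (b - s)) ln).
        -- apply continuous_Rdiv; [| |lra]; apply continuous_Rminus;
             first [apply continuous_id|apply continuous_const].
        -- apply continuous_ln, Rdiv_lt_0_compat; lra.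
      * destruct p; apply continuous_snd.
    + destruct (Hw (psi (fst p), snd p)) as [_ Ha].
      simpl in Ha. rewrite Hpsi in Ha by exact Hp. destruct p; exact Ha.
Qed.

Lemma locally_strip a b p : strip a b p -> locally p (strip a b).
Proof.
  intros [Ha Hb].
  assert (Hf : continuous (fun q : R * R => fst q) p)
    by (destruct p; apply continuous_fst).
  apply filter_and.
  - exact (locally_lt (fun _ => a) (fun q : R * R => fst q) p
      (continuous_const _ _) Hf Ha).
  - exact (locally_lt (fun q : R * R => fst q) (fun _ => b) p
      Hf (continuous_const _ _) Hb).
Qed.

Lemma segment_in_interval (a b s s' t : R) :
  a < s < b -> a < s' < b -> 0 <= t <= 1 -> a < (1 - t) * s + t * s' < b.
Proof.
  intros Hs Hs' Ht. replace ((1 - t) * s + t * s') with (s + t * (s' - s)) by ring.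
  destruct (Rle_dec s s').
  - assert (0 <= t * (s' - s) <= s' - s) by nra. lra.
  - assert (s' - s <= t * (s' - s) <= 0) by nra. lra.
Qed.

Lemma period_constant (v : R * R -> R) (a b s s' y : R) :
  (forall p, strip a b p -> continuous v p) ->
  (forall x, a < x < b ->
    exists k : Z, v (x, y + 2 * PI) - v (x, y) = 2 * IZR k * PI) ->
  a < s < b -> a < s' < b ->
  v (s, y + 2 * PI) - v (s, y) = v (s', y + 2 * PI) - v (s', y).
Proof.
  intros Hv Hk Hs Hs'.
  set (x := fun t => (1 - t) * s + t * s').
  assert (Hin : forall t, 0 <= t <= 1 -> a < x t < b)
    by (intros t Ht; apply segment_in_interval; assumption).
  assert (Hsec : forall z t, 0 <= t <= 1 -> continuous (fun t => v (x t, z)) t).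
  { intros z t Ht. apply (continuous_comp (fun t => (x t, z)) v).
    - apply (continuous_pair (U := R_UniformSpace) (V := R_UniformSpace));
        [|apply continuous_const].
      apply continuous_Rplus; apply continuous_Rmult;
        first [apply continuous_id | apply continuous_const
          | apply continuous_Rminus; [apply continuous_const|apply continuous_id]].
    - apply Hv, Hin, Ht. }
  pose proof (discrete_constant (fun t => v (x t, y + 2 * PI) - v (x t, y))) as H.
  cbv beta in H.
  replace (x 0) with s in H by (unfold x; ring).
  replace (x 1) with s' in H by (unfold x; ring).
  apply H. intros t Ht. split.
  - apply continuous_Rminus; apply Hsec, Ht.
  - apply Hk, Hin, Ht.
Qed.

(** The flux identity on a rectangle of height [2 * PI] says that the mean of
    [u] over a vertical segment is affine in the abscissa, with slope the
    period [k]. *)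
Lemma period_zero (u v : R -> R -> R) (a b M y : R) (k : Z) :
  0 <= M < b - a ->
  (forall s t, a < s < b -> divergence_free u v s t) ->
  (forall s s' t, a < s < b -> a < s' < b -> u s' t - u s t <= M) ->
  (forall s, a < s < b -> v s (y + 2 * PI) - v s y = 2 * IZR k * PI) -> k = 0%Z.
Proof.
  intros HM Hdiv Hu Hk. assert (HP := PI_RGT_0).
  (* The margin [d] leaves [s2 - s1 = (b - a + M) / 2], which exceeds [M]. *)
  set (d := (b - a - M) / 4).
  assert (Hd : 0 < d) by (unfold d; lra).
  set (s1 := a + d). set (s2 := b - d).
  assert (H12 : M < s2 - s1) by (unfold s1, s2, d; lra).
  assert (H1 : a < s1) by (unfold s1; lra).
  assert (H2 : s2 < b) by (unfold s2; lra).
  assert (Hrect : forall s t, s1 <= s <= s2 -> y <= t <= y + 2 * PI ->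
    divergence_free u v s t) by (intros s t Hs _; apply Hdiv; lra).
  assert (HF := flux_zero u v s1 s2 y (y + 2 * PI) Hrect ltac:(lra) ltac:(lra)).
  assert (HV := RInt_difference_bound (fun s => v s (y + 2 * PI)) (fun s => v s y)
    s1 s2 (2 * IZR k * PI) 0 ltac:(lra)
    (ex_RInt_v u v s1 s2 y (y + 2 * PI) Hrect (y + 2 * PI) s1 s2
      ltac:(lra) ltac:(lra) ltac:(lra) ltac:(lra))
    (ex_RInt_v u v s1 s2 y (y + 2 * PI) Hrect y s1 s2
      ltac:(lra) ltac:(lra) ltac:(lra) ltac:(lra))).
  assert (HU := RInt_difference_bound (fun t => u s2 t) (fun t => u s1 t)
    y (y + 2 * PI) 0 M ltac:(lra)
    (ex_RInt_u u v s1 s2 y (y + 2 * PI) Hrect s2 y (y + 2 * PI)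
      ltac:(lra) ltac:(lra) ltac:(lra) ltac:(lra))
    (ex_RInt_u u v s1 s2 y (y + 2 * PI) Hrect s1 y (y + 2 * PI)
      ltac:(lra) ltac:(lra) ltac:(lra) ltac:(lra))).
  unfold flux in HF.
  set (IU := RInt (fun t => u s2 t) y (y + 2 * PI)
    - RInt (fun t => u s1 t) y (y + 2 * PI)) in *.
  set (IV := RInt (fun s => v s (y + 2 * PI)) s1 s2
    - RInt (fun s => v s y) s1 s2) in *.
  assert (HV' : IV = 2 * IZR k * PI * (s2 - s1)).
  { assert (H : Rabs (IV - 2 * IZR k * PI * (s2 - s1)) <= 0 * (s2 - s1)).
    { apply HV. intros t Ht. rewrite Hk by lra.
      rewrite Rminus_diag, Rabs_R0. lra. }
    apply Rabs_le_between in H. lra. }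
  assert (HU' : Rabs IU <= M * (2 * PI)).
  { replace IU with (IU - 0 * (y + 2 * PI - y)) by ring.
    replace (M * (2 * PI)) with (M * (y + 2 * PI - y)) by ring.
    apply HU. intros t Ht.
    assert (u s2 t - u s1 t <= M) by (apply Hu; lra).
    assert (u s1 t - u s2 t <= M) by (apply Hu; lra).
    apply Rabs_le. lra. }
  replace IU with (IZR k * (s2 - s1) * (2 * PI)) in HU' by lra.
  apply Rabs_le_between in HU'.
  assert (Hup : IZR k * (s2 - s1) <= M)
    by (apply Rmult_le_reg_r with (2 * PI); lra).
  assert (Hlo : - M <= IZR k * (s2 - s1))
    by (apply Rmult_le_reg_r with (2 * PI); lra).
  destruct (Z.lt_trichotomy k 0) as [Hlt|[Heq|Hgt]]; [|exact Heq|]; exfalso.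
  - assert (IZR k <= -1) by (apply IZR_le; lia). nra.
  - assert (1 <= IZR k) by (apply IZR_le; lia). nra.
Qed.

(** * Descent to the annulus *)

Lemma annulus_polar A B s t :
  0 < A < B -> ln A < s < ln B -> annulus A B (polar (exp s) t).
Proof.
  intros HA Hs. unfold annulus. rewrite Cmod_polar by (apply Rlt_le, exp_pos).
  split.
  - rewrite <- (exp_ln A) by lra. apply exp_increasing, Hs.
  - rewrite <- (exp_ln B) by lra. apply exp_increasing, Hs.
Qed.

Lemma ln_annulus A B (z : C) :
  0 < A -> annulus A B z -> ln A < ln (Cmod z) < ln B.
Proof. intros HA [H1 H2]. split; apply ln_increasing; lra. Qed.

Lemma holomorphic_continuous (D : C -> Prop) (f : C -> C) (z : C) :
  holomorphic_on D f -> D z ->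
  @continuous C_UniformSpace C_UniformSpace f z.
Proof.
  intros Hf Hz P HP. apply (locally_C z (fun x => P (f x))).
  apply (ex_derive_continuous (K := C_AbsRing) (V := C_NormedModule) f z (Hf z Hz)).
  exact HP.
Qed.

Lemma continuous_polar {T : UniformSpace} (r t : T -> R) (p : T) :
  continuous r p -> continuous t p ->
  @continuous T C_UniformSpace (fun q => polar (r q) (t q)) p.
Proof.
  intros Hr Ht. unfold polar.
  apply (continuous_pair (U := R_UniformSpace) (V := R_UniformSpace));
    (apply continuous_Rmult; [exact Hr|]).
  - apply (continuous_comp t cos); [exact Ht|apply continuous_cos].
  - apply (continuous_comp t sin); [exact Ht|apply continuous_sin].
Qed.

Definition some_argument (z : C) : R :=
  proj1_sig (constructive_indefinite_description _ (argument_exists z)).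

Lemma some_argument_spec z : is_argument z (some_argument z).
Proof.
  exact (proj2_sig (constructive_indefinite_description _ (argument_exists z))).
Qed.

Lemma periodic_multiple (v : R -> R) :
  (forall y, v (y + 2 * PI) = v y) ->
  forall (k : Z) y, v (y + 2 * IZR k * PI) = v y.
Proof.
  intros Hv.
  assert (Hn : forall n y, v (y + 2 * INR n * PI) = v y).
  { induction n as [|n IH]; intros y.
    - f_equal. simpl. ring.
    - rewrite S_INR, <- (IH y), <- (Hv (y + 2 * INR n * PI)). f_equal. ring. }
  intros k y. destruct (Z_le_gt_dec 0 k) as [Hk|Hk].
  - rewrite <- (Z2Nat.id k Hk), <- INR_IZR_INZ. apply Hn.
  - rewrite <- (Hn (Z.to_nat (- k)) (y + 2 * IZR k * PI)).
    rewrite INR_IZR_INZ, Z2Nat.id, opp_IZR by lia. f_equal. ring.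
Qed.

(** Although no argument is continuous on the whole annulus, near a given point
    one may replace it by a continuous one, because [v] does not see the
    difference. *)
Lemma periodic_descends (v : R * R -> R) (A B : R) (z : C) :
  0 < A -> annulus A B z ->
  (forall p, strip (ln A) (ln B) p -> continuous v p) ->
  (forall s y, ln A < s < ln B -> v (s, y + 2 * PI) = v (s, y)) ->
  @continuous C_UniformSpace R_UniformSpace
    (fun z => v (ln (Cmod z), some_argument z)) z.
Proof.
  intros HA Hz Hv Hper.
  assert (Hm : @continuous C_UniformSpace R_UniformSpace Cmod z)
    by (apply (continuous_Cmod (fun z => z)), continuous_id).
  assert (Hpos : 0 < Cmod z) by (destruct Hz; lra).
  assert (Hdot : 0 < dot z z)
    by (unfold dot; rewrite <- Cmod_sqr; apply Rmult_lt_0_compat; lra).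
  assert (Hid : @continuous C_UniformSpace C_UniformSpace (fun w => w) z)
    by apply continuous_id.
  assert (Hcst : @continuous C_UniformSpace C_UniformSpace (fun _ => z) z)
    by apply continuous_const.
  assert (Hln : @continuous C_UniformSpace R_UniformSpace (fun w => ln (Cmod w)) z)
    by (apply (continuous_comp Cmod ln); [exact Hm|apply continuous_ln, Hpos]).
  apply continuous_ext_loc
    with (fun w : C => v (ln (Cmod w), some_argument z + turn z w)).
  - generalize (filter_and _ _
      (locally_lt (fun _ => 0) (fun w => dot z w) z (continuous_const _ _)
        (continuous_dot (fun _ => z) (fun w => w) z Hcst Hid) Hdot)
      (filter_and _ _
        (locally_lt (fun _ => A) Cmod z (continuous_const _ _) Hm (proj1 Hz))
        (locally_lt Cmod (fun _ => B) z Hm (continuous_const _ _) (proj2 Hz)))).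
    apply filter_imp. intros w [Hd Hw].
    destruct (argument_differ w (some_argument w) (some_argument z + turn z w))
      as [k Hk].
    + lra.
    + apply some_argument_spec.
    + apply turn_argument; [apply some_argument_spec|exact Hd].
    + replace (some_argument z + turn z w)
        with (some_argument w + 2 * IZR k * PI) by lra.
      apply (periodic_multiple (fun y => v (ln (Cmod w), y))).
      intros y. apply Hper, ln_annulus; assumption.
  - apply (continuous_comp (fun w : C => (ln (Cmod w), some_argument z + turn z w)) v).
    + apply (continuous_pair (U := R_UniformSpace) (V := R_UniformSpace)); [exact Hln|].
      apply continuous_Rplus; [apply continuous_const|].
      apply continuous_turn; [exact Hcst|exact Hid|lra].
    + apply Hv. unfold strip; simpl. apply ln_annulus; assumption.
Qed.

(** * Contraction of the map *)

Theorem theorem3p2 (A1 B1 A2 B2 : R)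
    (hA1 : 0 < A1) (hAB1 : A1 < B1) (hA2 : 0 < A2) (hAB2 : A2 < B2)
    (hmod : B1 / A1 > B2 / A2)
    (f : C -> C)
    (hmaps : maps_into (annulus A1 B1) (annulus A2 B2) f)
    (hf : holomorphic_on (annulus A1 B1) f) :
  @homotopically_trivial C_UniformSpace C_UniformSpace
    (annulus A1 B1) (annulus A2 B2) f.
Proof.
  set (a := ln A1). set (b := ln B1).
  assert (Hab : a < b) by (apply ln_increasing; lra).
  assert (HM : 0 <= ln B2 - ln A2 < b - a).
  { split.
    - assert (ln A2 < ln B2) by (apply ln_increasing; lra). lra.
    - unfold a, b. rewrite <- !ln_div by lra.
      apply ln_increasing; [apply Rdiv_lt_0_compat; lra|exact hmod]. }
  assert (Hpol : forall s t, a < s < b -> annulus A1 B1 (polar (exp s) t))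
    by (intros; apply annulus_polar; auto).
  set (G := fun p : R * R => f (polar (exp (fst p)) (snd p))).
  assert (HGc : forall p, strip a b p -> @continuous _ C_UniformSpace G p).
  { intros p Hp. unfold G.
    apply (continuous_comp (fun p : R * R => polar (exp (fst p)) (snd p) : C_UniformSpace)
      (f : C_UniformSpace -> C_UniformSpace)).
    - apply continuous_polar.
      + apply (continuous_comp fst exp); [destruct p; apply continuous_fst|].
        apply continuous_exp.
      + destruct p; apply continuous_snd.
    - apply holomorphic_continuous with (annulus A1 B1); [exact hf|apply Hpol, Hp]. }
  assert (HGa : forall p, strip a b p -> annulus A2 B2 (G p))
    by (intros p Hp; apply hmaps, Hpol, Hp).
  destruct (strip_argument G a b Hab) as [v Hv].
  { intros p Hp. split; [apply HGc, Hp|]. destruct (HGa p Hp). lra. }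
  assert (Hdiv : forall s t, a < s < b ->
    divergence_free (fun s t => ln (Cmod (G (s, t)))) (fun s t => v (s, t)) s t).
  { intros s t Hs.
    apply (log_divergence_free (fun s t => G (s, t))).
    - apply cauchy_riemann_polar, hf, Hpol, Hs.
    - destruct (HGa (s, t) Hs). lra.
    - apply continuity_2d_pt_filterlim.
      apply filterlim_ext with v; [intros [? ?]; reflexivity|].
      apply (Hv (s, t)), Hs.
    - apply locally_2d_locally.
      generalize (locally_strip a b (s, t) Hs). apply filter_imp.
      intros [x y] Hxy. split; [destruct (HGa _ Hxy); simpl in *; lra|].
      apply Hv, Hxy. }
  assert (Hint : forall y s, a < s < b ->
    exists k : Z, v (s, y + 2 * PI) - v (s, y) = 2 * IZR k * PI).
  { intros y s Hs. apply (argument_differ (G (s, y))).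
    - destruct (HGa (s, y) Hs). lra.
    - apply Hv, Hs.
    - replace (G (s, y)) with (G (s, y + 2 * PI)); [apply Hv, Hs|].
      unfold G, polar; simpl.
      rewrite cos_plus, sin_plus, cos_2PI, sin_2PI.
      f_equal. f_equal; ring. }
  assert (Hper : forall s y, a < s < b -> v (s, y + 2 * PI) = v (s, y)).
  { intros s y Hs. destruct (Hint y s Hs) as [k Hk].
    assert (Hk0 : k = 0%Z).
    { apply (period_zero (fun s t => ln (Cmod (G (s, t)))) (fun s t => v (s, t))
        a b (ln B2 - ln A2) y k HM Hdiv).
      - intros s' s'' t Hs' Hs''.
        destruct (ln_annulus _ _ _ hA2 (HGa (s', t) Hs')).
        destruct (ln_annulus _ _ _ hA2 (HGa (s'', t) Hs'')). lra.
      - intros s' Hs'. rewrite <- Hk. apply (period_constant v a b); auto.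
        intros p Hp; apply Hv, Hp. }
    subst k. lra. }
  (* [W] is a continuous argument of [f] on the annulus. *)
  set (W := fun z : C => v (ln (Cmod z), some_argument z)).
  assert (HW : forall z, annulus A1 B1 z -> is_argument (f z) (W z)).
  { intros z Hz.
    destruct (Hv (ln (Cmod z), some_argument z)) as [_ Ha].
    { apply ln_annulus; assumption. }
    unfold G in Ha. simpl in Ha.
    rewrite exp_ln in Ha by (destruct Hz; lra).
    rewrite <- (some_argument_spec z) in Ha. exact Ha. }
  assert (HWc : forall z, annulus A1 B1 z ->
    @continuous C_UniformSpace R_UniformSpace W z).
  { intros z Hz. apply (periodic_descends v A1 B1); auto.
    intros p Hp; apply Hv, Hp. }
  set (c := (A2 + B2) / 2).
  assert (Hc : A2 < c < B2) by (unfold c; lra).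
  assert (Hlc : ln A2 < ln c < ln B2) by (split; apply ln_increasing; lra).
  exists (polar c 0). split.
  { unfold annulus. rewrite Cmod_polar; lra. }
  (* A straight segment in logarithmic coordinates, from [ln (f z)] to [ln c]. *)
  exists (fun p : R * C =>
    polar (exp ((1 - fst p) * ln (Cmod (f (snd p))) + fst p * ln c))
      ((1 - fst p) * W (snd p))).
  split; [|split; [|split]].
  - apply continuous_on_forall. intros [t z] [_ Hz]. simpl in Hz.
    assert (Ht : @continuous (prod_UniformSpace R_UniformSpace C_UniformSpace)
      R_UniformSpace (fun q => 1 - fst q) (t, z)).
    { apply continuous_Rminus; [apply continuous_const|apply continuous_fst]. }
    apply continuous_polar.
    + apply (continuous_comp (fun p : prod_UniformSpace R_UniformSpace C_UniformSpace =>
        (1 - fst p) * ln (Cmod (f (snd p))) + fst p * ln c) exp);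
        [|apply continuous_exp].
      apply continuous_Rplus; apply continuous_Rmult.
      * exact Ht.
      * apply (continuous_comp (fun p : prod_UniformSpace R_UniformSpace C_UniformSpace =>
          Cmod (f (snd p))) ln).
        -- apply continuous_Cmod.
           apply (continuous_comp snd (f : C_UniformSpace -> C_UniformSpace));
             [apply continuous_snd|].
           apply holomorphic_continuous with (annulus A1 B1); assumption.
        -- apply continuous_ln. destruct (hmaps z Hz). simpl. lra.
      * apply continuous_fst.
      * apply continuous_const.
    + apply continuous_Rmult; [exact Ht|].
      apply (continuous_comp snd (W : C_UniformSpace -> R_UniformSpace));
        [apply continuous_snd|apply HWc, Hz].
  - intros [t z] [Ht Hz]. simpl in *.
    apply annulus_polar; [lra|].
    apply segment_in_interval; [|exact Hlc|exact Ht].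
    apply ln_annulus; [exact hA2|apply hmaps, Hz].
  - intros z Hz. cbn [fst snd].
    replace ((1 - 0) * ln (Cmod (f z)) + 0 * ln c) with (ln (Cmod (f z))) by ring.
    rewrite exp_ln by (destruct (hmaps z Hz); lra).
    replace ((1 - 0) * W z) with (W z) by ring.
    symmetry. apply HW, Hz.
  - intros z Hz. cbn [fst snd].
    replace ((1 - 1) * ln (Cmod (f z)) + 1 * ln c) with (ln c) by ring.
    rewrite exp_ln by lra. f_equal. ring.
Qed.
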